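(* Let $\mathrm{R}$ be a real closed field and let $\gamma:V\to\mathrm{R}^k$ be a parametrized path, $V\subset\mathrm{R}^{k+1}$, such that its base $U=\pi_{1\ldots k}(V)$ is closed and bounded. Then the image of $\gamma$ is semi-algebraically contractible.
   Context: $\pi_{1\ldots k}:\mathrm{R}^{k+1}\to\mathrm{R}^k$ is the projection onto the first $k$ coordinates. A parametrized path is a continuous semi-algebraic mapping $\gamma:V\to\mathrm{R}^k$ with $V\subset\mathrm{R}^{k+1}$ such that, writing $U=\pi_{1\ldots k}(V)\subset\mathrm{R}^k$ (the base of $\gamma$), there exist a continuous semi-algebraic function $\ell:U\to[0,+\infty)$ and a point $a\in\mathrm{R}^k$ with: (1) $V=\{(x,t)\mid x\in U,\ 0\le t\le\ell(x)\}$; (2) for all $x\in U$, $\gamma(x,0)=a$; (3) for all $x\in U$, $\gamma(x,\ell(x))=x$; (4) for all $x,y\in U$, $s\in[0,\ell(x)]$, $t\in[0,\ell(y)]$: $\gamma(x,s)=\gamma(y,t)$ implies $s=t$; (5) for all $x,y\in U$ and $s\in[0,\min(\ell(x),\ell(y))]$: $\gamma(x,s)=\gamma(y,s)$ implies $\gamma(x,t)=\gamma(y,t)$ for all $t\le s$. *)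

(* Defs.v *)
From HB Require Import structures.
From mathcomp Require Import all_boot all_order all_algebra.
From mathcomp Require mpoly.
From mathcomp Require Import all_classical all_reals all_analysis.

Set Implicit Arguments.
Unset Strict Implicit.
Unset Printing Implicit Defensive.

Import Order.TTheory GRing.Theory Num.Theory.
Import numFieldNormedType.Exports.

Local Open Scope classical_set_scope.
Local Open Scope ring_scope.

(** MathComp world, with MathComp-Analysis for topology.  R^n is ['rV[R]_n]
    with the sup norm, whose topology is the Euclidean one.  A map defined on a
    subset A of R^m is a total function considered only on A; its values
    outside A are irrelevant, continuity being for the subspace topology. *)

(** [mpoly] is qualified because its notations clash with those of
    MathComp-Analysis. *)
Definition mpeval (R : rcfType) (n : nat) (p : mpoly.mpoly n R)
    (x : 'rV[R]_n) : R :=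
  mpoly.meval (fun i => x ord0 i) p.

Inductive semialgebraic (R : rcfType) (n : nat) : set 'rV[R]_n -> Prop :=
| semialgebraic_eq0 (p : mpoly.mpoly n R) :
    semialgebraic [set x | mpeval p x = 0]
| semialgebraic_gt0 (p : mpoly.mpoly n R) :
    semialgebraic [set x | 0 < mpeval p x]
| semialgebraicC (A : set 'rV[R]_n) : semialgebraic A -> semialgebraic (~` A)
| semialgebraicU (A B : set 'rV[R]_n) :
    semialgebraic A -> semialgebraic B -> semialgebraic (A `|` B)
| semialgebraicI (A B : set 'rV[R]_n) :
    semialgebraic A -> semialgebraic B -> semialgebraic (A `&` B).

Definition graph_on (R : rcfType) (m n : nat) (A : set 'rV[R]_m)
    (f : 'rV[R]_m -> 'rV[R]_n) : set 'rV[R]_(m + n) :=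
  [set row_mx x (f x) | x in A].

Definition semialgebraic_map (R : rcfType) (m n : nat)
    (A : set 'rV[R]_m) (B : set 'rV[R]_n) (f : 'rV[R]_m -> 'rV[R]_n) : Prop :=
  [/\ semialgebraic A, semialgebraic B, set_fun A B f
    & semialgebraic (graph_on A f)].

(** The point (x, t) of R^(k+1), and the last coordinate of a point. *)
Definition pair_pt (R : rcfType) (k : nat) (x : 'rV[R]_k) (t : R) :
    'rV[R]_(k + 1) :=
  row_mx x t%:M.

Definition last_coord (R : rcfType) (k : nat) (z : 'rV[R]_(k + 1)) : R :=
  rsubmx z ord0 ord0.

Definition path_base (R : rcfType) (k : nat) (V : set 'rV[R]_(k + 1)) :
    set 'rV[R]_k :=
  [set lsubmx z | z in V].

(** The function ell is real-valued; it is viewed as a map to R^1 in order to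
    say that it is semi-algebraic.  In the last clause t ranges over the
    t >= 0, since gamma (x, t) is only defined for those. *)
Definition parametrized_path (R : rcfType) (k : nat)
    (V : set 'rV[R]_(k + 1)) (gamma : 'rV[R]_(k + 1) -> 'rV[R]_k) : Prop :=
  let U := path_base V in
  [/\ semialgebraic_map V setT gamma,
      {within V, continuous gamma}
    & exists (ell : 'rV[R]_k -> R) (a : 'rV[R]_k),
      (semialgebraic_map U [set y : 'rV[R]_1 | 0 <= y ord0 ord0]
         (fun x => (ell x)%:M) /\
       {within U, continuous ell}) /\
      [/\ V = [set z | U (lsubmx z) /\
                       0 <= last_coord z <= ell (lsubmx z)],
          (forall x, U x -> gamma (pair_pt x 0) = a),
          (forall x, U x -> gamma (pair_pt x (ell x)) = x),
          (forall x y s t, U x -> U y ->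
             0 <= s <= ell x -> 0 <= t <= ell y ->
             gamma (pair_pt x s) = gamma (pair_pt y t) -> s = t)
        & (forall x y s, U x -> U y ->
             0 <= s <= Num.min (ell x) (ell y) ->
             gamma (pair_pt x s) = gamma (pair_pt y s) ->
             forall t, 0 <= t <= s ->
               gamma (pair_pt x t) = gamma (pair_pt y t))]].

Definition cylinder (R : rcfType) (m : nat) (S : set 'rV[R]_m) :
    set 'rV[R]_(m + 1) :=
  [set z | S (lsubmx z) /\ 0 <= last_coord z <= 1].

Definition semialgebraically_homotopic (R : rcfType) (m n : nat)
    (S : set 'rV[R]_m) (T : set 'rV[R]_n) (f g : 'rV[R]_m -> 'rV[R]_n) : Prop :=
  exists h : 'rV[R]_(m + 1) -> 'rV[R]_n,
    [/\ semialgebraic_map (cylinder S) T h,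
        {within cylinder S, continuous h},
        (forall x, S x -> h (pair_pt x 0) = f x)
      & (forall x, S x -> h (pair_pt x 1) = g x)].

(** The identity of S is homotopic, inside S, to a constant map.  If S is
    nonempty this forces c to be a point of S; the empty set, whose identity is
    vacuously constant, counts as contractible. *)
Definition semialgebraically_contractible (R : rcfType) (n : nat)
    (S : set 'rV[R]_n) : Prop :=
  exists c : 'rV[R]_n, semialgebraically_homotopic S S id (cst c).

(* Main.v *)
(* The contraction slides back along the paths: h(gamma(x, s), t) = gamma(x, s(1 - t)),
   which is well defined by conditions (4) and (5).  It is continuous because the closed
   bounded set V x [0, 1] maps onto gamma(V) x [0, 1] by a quotient map.  Compactness, which
   fails over a general real closed field, is replaced by the following: a decreasing
   semialgebraic family of nonempty bounded sets C_d, d > 0, has a cluster point as d -> 0.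
   Its coordinates are found one after the other from the existence of suprema of bounded
   semialgebraic subsets of R, whose indicators are constant between finitely many roots
   of polynomials.  Quantifier elimination shows that the sets involved are
   semialgebraic. *)
Require Import Defs.
From mathcomp Require Import all_boot all_order all_algebra.
From mathcomp Require mpoly polyrcf ordered_qelim qe_rcf.
From mathcomp Require Import all_classical all_reals all_analysis.
Import numFieldNormedType.Exports.
Local Open Scope classical_set_scope.
Local Open Scope ring_scope.

Set Implicit Arguments.
Unset Strict Implicit.
Unset Printing Implicit Defensive.
Import Order.TTheory GRing.Theory Num.Theory.
Import -(notations) mpoly.

(** * Polynomial maps and Boolean closure of semialgebraic sets *)

Section Polynomial.
Variable R : rcfType.

(** Expanding p into monomials leaves only finite sums and products. The class [P] is later taken to
    be the polynomial functions, the evaluations of first-order terms, the univariate polynomials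
    and the continuous functions. *)
Lemma meval_closed (T : Type) (P : (T -> R) -> Prop) (n : nat)
    (p : mpoly n R) (v : 'I_n -> T -> R) :
  (forall c, P (cst c)) -> (forall f g, P f -> P g -> P (fun x => f x + g x)) ->
  (forall f g, P f -> P g -> P (fun x => f x * g x)) ->
  (forall i, P (v i)) -> P (fun x => meval (v^~ x) p).
Proof.
move=> Pc PD PM Pv.
have Psum (I : Type) (r : seq I) (F : I -> T -> R) :
    (forall i, P (F i)) -> P (fun x => \sum_(i <- r) F i x).
  move=> PF; elim: r => [|i r IHr].
    by under eq_fun do rewrite big_nil; exact: Pc.
  by under eq_fun do rewrite big_cons; exact: PD.
have Pprod (I : Type) (r : seq I) (F : I -> T -> R) :
    (forall i, P (F i)) -> P (fun x => \prod_(i <- r) F i x).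
  move=> PF; elim: r => [|i r IHr].
    by under eq_fun do rewrite big_nil; exact: Pc.
  by under eq_fun do rewrite big_cons; exact: PM.
under eq_fun do rewrite mevalE.
apply: Psum => m; apply: (PM (cst _)); first exact: Pc.
apply: Pprod => i; elim: (m i) => [|k IHk].
  by under eq_fun do rewrite expr0; exact: Pc.
by under eq_fun do rewrite exprS; exact: PM.
Qed.

Definition polynomial_fun n (f : 'rV[R]_n -> R) :=
  exists p : mpoly n R, f = mpeval p.

Definition polynomial_map m n (f : 'rV[R]_m -> 'rV[R]_n) :=
  forall j, polynomial_fun (fun x => f x ord0 j).

Lemma polynomial_fun_cst n c : @polynomial_fun n (cst c).
Proof. by exists (mpolyC n c); apply/funext => x; rewrite /mpeval mevalC. Qed.

Lemma polynomial_fun_coord n i : @polynomial_fun n (fun x => x ord0 i).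
Proof. by exists (mpolyX R (mnm1 i)); apply/funext => x; rewrite /mpeval mevalXU. Qed.

Lemma polynomial_funD n (f g : 'rV[R]_n -> R) :
  polynomial_fun f -> polynomial_fun g -> polynomial_fun (fun x => f x + g x).
Proof.
by move=> [p ->] [q ->]; exists (p + q)%R; apply/funext => x; rewrite /mpeval mevalD.
Qed.

Lemma polynomial_funM n (f g : 'rV[R]_n -> R) :
  polynomial_fun f -> polynomial_fun g -> polynomial_fun (fun x => f x * g x).
Proof.
by move=> [p ->] [q ->]; exists (p * q)%R; apply/funext => x; rewrite /mpeval mevalM.
Qed.

Lemma polynomial_funN n (f : 'rV[R]_n -> R) :
  polynomial_fun f -> polynomial_fun (fun x => - f x).
Proof.
by move=> [p ->]; exists (- p)%R; apply/funext => x; rewrite /mpeval mevalN.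
Qed.

Lemma polynomial_funB n (f g : 'rV[R]_n -> R) :
  polynomial_fun f -> polynomial_fun g -> polynomial_fun (fun x => f x - g x).
Proof. by move=> pf pg; apply/polynomial_funD => //; exact/polynomial_funN. Qed.

Lemma polynomial_fun_comp m n (f : 'rV[R]_m -> 'rV[R]_n) (g : 'rV[R]_n -> R) :
  polynomial_map f -> polynomial_fun g -> polynomial_fun (fun x => g (f x)).
Proof.
move=> pf [p ->]; apply: (@meval_closed _ (@polynomial_fun m) n p (fun i x => f x ord0 i)).
- exact: polynomial_fun_cst.
- exact: polynomial_funD.
- exact: polynomial_funM.
- exact: pf.
Qed.

Lemma polynomial_map_comp m n q (f : 'rV[R]_m -> 'rV[R]_n)
    (g : 'rV[R]_n -> 'rV[R]_q) :
  polynomial_map f -> polynomial_map g -> polynomial_map (fun x => g (f x)).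
Proof. by move=> pf pg j; exact: polynomial_fun_comp pf (pg j). Qed.

Lemma polynomial_map_id m : @polynomial_map m m id.
Proof. by move=> j; exact: polynomial_fun_coord. Qed.

Lemma polynomial_lsubmx m n q (f : 'rV[R]_m -> 'rV[R]_(n + q)) :
  polynomial_map f -> polynomial_map (fun x => lsubmx (f x)).
Proof. by move=> pf j; under eq_fun do rewrite mxE; exact: pf. Qed.

Lemma polynomial_rsubmx m n q (f : 'rV[R]_m -> 'rV[R]_(n + q)) :
  polynomial_map f -> polynomial_map (fun x => rsubmx (f x)).
Proof. by move=> pf j; under eq_fun do rewrite mxE; exact: pf. Qed.

Lemma polynomial_row_mx m n q (f : 'rV[R]_m -> 'rV[R]_n)
    (g : 'rV[R]_m -> 'rV[R]_q) :
  polynomial_map f -> polynomial_map g ->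
  polynomial_map (fun x => row_mx (f x) (g x)).
Proof.
move=> pf pg j; under eq_fun do rewrite mxE.
by case: (fintype.split j) => i; [exact: pf|exact: pg].
Qed.

Lemma polynomial_scalar m (f : 'rV[R]_m -> R) :
  polynomial_fun f -> polynomial_map (fun x => (f x)%:M : 'rV_1).
Proof. by move=> pf j; under eq_fun do rewrite !ord1 mxE mulr1n; exact: pf. Qed.

Lemma polynomial_map_cst m n (a : 'rV[R]_n) : @polynomial_map m n (cst a).
Proof. by move=> j; exact: polynomial_fun_cst. Qed.

Lemma polynomial_coord m n (f : 'rV[R]_m -> 'rV[R]_n) i :
  polynomial_map f -> polynomial_fun (fun x => f x ord0 i).
Proof. exact. Qed.

Lemma semialgebraic_preimage m n (f : 'rV[R]_m -> 'rV[R]_n) (A : set 'rV[R]_n) :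
  polynomial_map f -> semialgebraic A -> semialgebraic [set x | A (f x)].
Proof.
move=> pf; elim=> {A} [p|p|A _ hA|A B _ hA _ hB|A B _ hA _ hB].
- have [q e] : polynomial_fun (fun x => mpeval p (f x)).
    by apply: polynomial_fun_comp => //; exists p.
  rewrite (_ : [set _ | _] = [set x | mpeval q x = 0]); first exact: semialgebraic_eq0.
  by rewrite -e.
- have [q e] : polynomial_fun (fun x => mpeval p (f x)).
    by apply: polynomial_fun_comp => //; exists p.
  rewrite (_ : [set _ | _] = [set x | 0 < mpeval q x]); first exact: semialgebraic_gt0.
  by rewrite -e.
- exact: semialgebraicC.
- exact: semialgebraicU.
- exact: semialgebraicI.
Qed.

Lemma semialgebraic_eq n (f g : 'rV[R]_n -> R) :
  polynomial_fun f -> polynomial_fun g -> semialgebraic [set x | f x = g x].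
Proof.
move=> pf pg; have [p e] := polynomial_funB pf pg.
rewrite (_ : [set _ | _] = [set x | mpeval p x = 0]); first exact: semialgebraic_eq0.
by rewrite -e; apply/seteqP; split => x /= => [->|/eqP]; rewrite ?subrr // subr_eq0 => /eqP.
Qed.

Lemma semialgebraic_lt n (f g : 'rV[R]_n -> R) :
  polynomial_fun f -> polynomial_fun g -> semialgebraic [set x | f x < g x].
Proof.
move=> pf pg; have [p e] := polynomial_funB pg pf.
rewrite (_ : [set _ | _] = [set x | 0 < mpeval p x]); first exact: semialgebraic_gt0.
by rewrite -e; apply/seteqP; split => x /=; rewrite subr_gt0.
Qed.

Lemma semialgebraic_le n (f g : 'rV[R]_n -> R) :
  polynomial_fun f -> polynomial_fun g -> semialgebraic [set x | f x <= g x].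
Proof.
move=> pf pg; rewrite (_ : [set _ | _] = ~` [set x | g x < f x]).
  exact/semialgebraicC/semialgebraic_lt.
by apply/seteqP; split => x /=; rewrite leNgt => /negP.
Qed.

Lemma semialgebraicT n : semialgebraic [set: 'rV[R]_n].
Proof.
rewrite (_ : setT = [set x : 'rV[R]_n | cst 0 x = cst (0 : R) x]).
  by apply: semialgebraic_eq; exact: polynomial_fun_cst.
by apply/seteqP; split.
Qed.

Lemma semialgebraic_forall (I : finType) n (A : I -> set 'rV[R]_n) :
  (forall i, semialgebraic (A i)) -> semialgebraic [set x | forall i, A i x].
Proof.
move=> hA; rewrite (_ : [set _ | _] = [set x | forall i, i \in enum I -> A i x]).
  elim: (enum I) => [|i s IHs].
    by rewrite (_ : [set _ | _] = setT); [exact: semialgebraicT|apply/seteqP; split].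
  rewrite (_ : [set _ | _] = A i `&` [set x | forall j, j \in s -> A j x]).
    exact: semialgebraicI.
  apply/seteqP; split => x /=.
    by move=> h; split=> [|j js]; apply: h; rewrite inE ?eqxx ?js ?orbT.
  by move=> [Ai As] j; rewrite inE => /predU1P[->//|]; exact: As.
by apply/seteqP; split => x h i //; apply: h; rewrite mem_enum.
Qed.

Lemma semialgebraic_imply n (A B : set 'rV[R]_n) :
  semialgebraic A -> semialgebraic B -> semialgebraic [set x | A x -> B x].
Proof.
move=> hA hB; rewrite (_ : [set _ | _] = ~` A `|` B).
  by apply: semialgebraicU => //; exact: semialgebraicC.
apply/seteqP; split => x /=; last by case.
by move=> AB; have [/AB|] := pselect (A x); [right|left].
Qed.

End Polynomial.

Ltac polynomial := rewrite /last_coord /pair_pt; repeat first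
  [ assumption | exact: polynomial_map_id | exact: polynomial_fun_cst
  | exact: polynomial_map_cst | apply: polynomial_lsubmx
  | apply: polynomial_rsubmx | apply: polynomial_row_mx
  | apply: polynomial_scalar | apply: polynomial_funD | apply: polynomial_funN
  | apply: polynomial_funM | apply: polynomial_coord ].

(** * Quantifier elimination and projections of semialgebraic sets *)

Section Projection.
Import ordered_qelim.ord.
Variable R : rcfType.

(** Formulas are evaluated at lists. Entries past the end read as 0, as do variables outside the
    environment, so [mpeval_term] needs no condition on the length of the list. *)
Definition row_of_seq n (e : seq R) : 'rV[R]_n := \row_i e`_i.

Definition seq_of_row n (x : 'rV[R]_n) : seq R := [seq x ord0 i | i <- enum 'I_n].

Lemma size_seq_of_row n (x : 'rV[R]_n) : size (seq_of_row x) = n.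
Proof. by rewrite size_map size_enum_ord. Qed.

Lemma nth_seq_of_row n (x : 'rV[R]_n) (i : 'I_n) : (seq_of_row x)`_i = x ord0 i.
Proof. by rewrite (nth_map i) ?size_enum_ord // nth_ord_enum. Qed.

Lemma row_of_seq_cat m n (x : 'rV[R]_m) (s : seq R) :
  row_of_seq (m + n) (seq_of_row x ++ s) = row_mx x (row_of_seq n s).
Proof.
apply/rowP => i; rewrite !mxE nth_cat size_seq_of_row.
case: fintype.splitP => j ->; first by rewrite nth_seq_of_row.
by rewrite mxE addKn.
Qed.

Lemma mpeval_term n (p : mpoly n R) :
  exists t, forall e, mpeval p (row_of_seq n e) = GRing.eval e t.
Proof.
pose P (f : seq R -> R) := exists t, forall e, f e = GRing.eval e t.
apply: (@meval_closed _ _ P n p (fun i e => row_of_seq n e ord0 i)) => /=.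
- by move=> c; exists (GRing.Const c).
- by move=> f g [t ft] [u gu]; exists (GRing.Add t u) => e; rewrite ft gu.
- by move=> f g [t ft] [u gu]; exists (GRing.Mul t u) => e; rewrite ft gu.
- by move=> i; exists (GRing.Var _ i) => e; rewrite mxE.
Qed.

Lemma semialgebraic_formula n (A : set 'rV[R]_n) : semialgebraic A ->
  exists f, forall e, A (row_of_seq n e) <-> holds e f.
Proof.
elim=> {A} [p|p|A _ [f hf]|A B _ [f hf] _ [g hg]|A B _ [f hf] _ [g hg]].
- by have [t ht] := mpeval_term p; exists (Equal t (GRing.Const 0)) => e /=; rewrite ht.
- by have [t ht] := mpeval_term p; exists (Lt (GRing.Const 0) t) => e /=; rewrite ht.
- by exists (Not f) => e /=; rewrite -hf.
- by exists (Or f g) => e /=; rewrite -hf -hg.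
- by exists (And f g) => e /=; rewrite -hf -hg.
Qed.

Lemma rterm_polynomial n (t : GRing.term R) : GRing.rterm t ->
  polynomial_fun (fun x : 'rV[R]_n => GRing.eval (seq_of_row x) t).
Proof.
elim: t => //= [i _|c _|k _|t IHt u IHu /andP[/IHt ht /IHu hu]|t IHt /IHt|
  t IHt k /IHt ht|t IHt u IHu /andP[/IHt ht /IHu hu]|t IHt k /IHt ht].
- have [ilt|ige] := ltnP i n.
    under eq_fun do rewrite (nth_seq_of_row _ (Ordinal ilt)).
    exact: polynomial_fun_coord.
  (* A variable of index at least n takes the default value 0, hence is constant. *)
  under eq_fun do rewrite nth_default ?size_seq_of_row //.
  exact: polynomial_fun_cst.
- exact: polynomial_fun_cst.
- exact: polynomial_fun_cst.
- exact: polynomial_funD.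
- exact: polynomial_funN.
- under eq_fun do rewrite -mulr_natr.
  by apply: polynomial_funM => //; exact: polynomial_fun_cst.
- exact: polynomial_funM.
- elim: k => [|k IHk].
    by under eq_fun do rewrite expr0; exact: polynomial_fun_cst.
  by under eq_fun do rewrite exprS; exact: polynomial_funM.
Qed.

Lemma semialgebraic_qf_eval n f : qf_form f -> rformula f ->
  semialgebraic [set x : 'rV[R]_n | qf_eval (seq_of_row x) f].
Proof.
elim: f => //= [b _ _|t u _ /andP[ht hu]|t u _ /andP[ht hu]|t u _ /andP[ht hu]
  |f IHf g IHg /andP[qf qg] /andP[rf rg]|f IHf g IHg /andP[qf qg] /andP[rf rg]
  |f IHf g IHg /andP[qf qg] /andP[rf rg]|f IHf qf rf].
- case: b.
    by rewrite (_ : [set _ | _] = setT); [exact: semialgebraicT|apply/seteqP; split].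
  rewrite (_ : [set _ | _] = ~` setT); first exact/semialgebraicC/semialgebraicT.
  by apply/seteqP; split => x //= /(_ Logic.I).
- have := semialgebraic_eq (@rterm_polynomial n _ ht) (@rterm_polynomial n _ hu).
  by congr (semialgebraic _); apply/seteqP; split => x /= /eqP.
- exact: (semialgebraic_lt (@rterm_polynomial n _ ht) (@rterm_polynomial n _ hu)).
- exact: (semialgebraic_le (@rterm_polynomial n _ ht) (@rterm_polynomial n _ hu)).
- have := semialgebraicI (IHf qf rf) (IHg qg rg).
  by congr (semialgebraic _); apply/seteqP; split => x /= /andP.
- have := semialgebraicU (IHf qf rf) (IHg qg rg).
  by congr (semialgebraic _); apply/seteqP; split => x /= /orP.
- have := semialgebraic_imply (IHf qf rf) (IHg qg rg).
  by congr (semialgebraic _); apply/seteqP; split => x /= /implyP.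
- have := semialgebraicC (IHf qf rf).
  by congr (semialgebraic _); apply/seteqP; split => x /= /negP.
Qed.

(** Quantifier elimination over real closed fields: [to_rform] first removes inverses, then [wproj]
    eliminates each quantifier, and the resulting formula is a Boolean combination of polynomial
    conditions. *)
Lemma semialgebraic_holds n f :
  semialgebraic [set x : 'rV[R]_n | holds (seq_of_row x) f].
Proof.
pose proj i bc := qe_rcf.qfr_to_formula (@qe_rcf.wproj R i bc).
pose q := quantifier_elim proj (to_rform f).
have /andP[qq rq] : qf_form q && rformula q.
  exact: quantifier_elim_wf (@qe_rcf.wf_QE_wproj R) _ (to_rform_rformula f).
have := @semialgebraic_qf_eval n _ qq rq.
congr (semialgebraic _); apply/seteqP; split => x /=.
  by move/(qe_rcf.rcf_satP (seq_of_row x) f).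
by move=> /(qe_rcf.rcf_satP (seq_of_row x) f).
Qed.

(** Assigning the variable of index [size e] appends a value to the environment, so quantifying over
    n, ..., n + m - 1 in turn appends m values. *)
Lemma holds_exists_iota (f : formula R) (e : seq R) n m : size e = n ->
  holds e (foldr Exists f (iota n m)) <->
  exists2 s, size s = m & holds (e ++ s) f.
Proof.
elim: m n e => [|m IHm] n e en /=.
  split=> [ef|[s /size0nil ->]]; last by rewrite cats0.
  by exists [::]; rewrite ?cats0.
have step x : set_nth 0 e n x = rcons e x.
  by rewrite -en; elim: (e) => //= y t ->.
split=> [[x]|[[//|x s] [sm] h]].
  rewrite step => /IHm[]; first by rewrite size_rcons en.
  by move=> s sm h; exists (x :: s); rewrite /= ?sm // -cat_rcons.
exists x; rewrite step; apply/IHm; first by rewrite size_rcons en.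
by exists s; rewrite ?cat_rcons.
Qed.

(** The Tarski-Seidenberg theorem: a formula for the total set is quantified over its last n
    variables, and the quantifiers are then eliminated. *)
Lemma semialgebraic_exists m n (P : 'rV[R]_m -> 'rV[R]_n -> Prop) :
  semialgebraic [set z : 'rV[R]_(m + n) | P (lsubmx z) (rsubmx z)] ->
  semialgebraic [set x | exists y, P x y].
Proof.
move=> /semialgebraic_formula[f hf].
have := @semialgebraic_holds m (foldr Exists f (iota m n)).
congr (semialgebraic _); apply/seteqP; split => x /=.
  move/holds_exists_iota; rewrite size_seq_of_row => /(_ erefl)[s _ /hf].
  by rewrite row_of_seq_cat /= row_mxKl row_mxKr => ?; exists (row_of_seq n s).
move=> [y Pxy]; apply/holds_exists_iota; first exact: size_seq_of_row.
exists (seq_of_row y); first exact: size_seq_of_row.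
apply/hf; rewrite row_of_seq_cat /= row_mxKl row_mxKr.
suff -> : row_of_seq n (seq_of_row y) = y by [].
by apply/rowP => i; rewrite mxE nth_seq_of_row.
Qed.

End Projection.

(** * Semialgebraic subsets of the line and their suprema *)

Section Tame.
Variable R : rcfType.

(** These are the finite unions of points and open intervals, possibly unbounded, with endpoints in
    s. *)
Definition tame (A : set R) :=
  exists s : seq R, forall x y, x <= y ->
    (forall z, z \in s -> ~ (x <= z <= y)) -> (A x <-> A y).

(** Covers every Boolean combination of A and B at once: the exceptional points of both are put
    together. *)
Lemma tame_combine (A B C : set R) : tame A -> tame B ->
  (forall x y, (A x <-> A y) -> (B x <-> B y) -> (C x <-> C y)) -> tame C.
Proof.
move=> [s hs] [t ht] h; exists (s ++ t) => x y xy hst.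
by apply: h; [apply: hs|apply: ht] => // z zs; apply: hst; rewrite mem_cat zs ?orbT.
Qed.

(** By the intermediate value property, the sign of a nonzero polynomial changes only at its roots.
    The zero polynomial is set apart, its roots not being finite in number. *)
Lemma tame_sgr (P : R -> Prop) (q : {poly R}) : tame [set r | P (Num.sg q.[r])].
Proof.
have [->|q0] := eqVneq q 0; first by exists [::] => x y _ _ /=; rewrite !horner0.
exists (polyrcf.rootsR q) => x y xy hxy /=.
suff -> : Num.sg q.[x] = Num.sg q.[y] by [].
apply: (@polyrcf.polyrN0_itv _ `[x, y]); rewrite ?in_itv /= ?lexx ?xy //.
move=> z zxy; apply/negP => rz; apply: (hxy z); last by rewrite in_itv in zxy.
by rewrite -(polyrcf.roots_on_rootsR q0) in_itv.
Qed.

Lemma semialgebraic_tame (A : set 'rV[R]_1) :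
  semialgebraic A -> tame [set r | A r%:M].
Proof.
have mpoly1 (p : mpoly 1 R) : exists q : {poly R}, forall r, mpeval p r%:M = q.[r].
  pose P (f : R -> R) := exists q : {poly R}, forall r, f r = q.[r].
  apply: (@meval_closed _ _ P 1 p (fun i r => (r%:M : 'rV_1) ord0 i)) => /=.
  - by move=> c; exists c%:P => r; rewrite hornerC.
  - by move=> f g [t ft] [u gu]; exists (t + u) => r; rewrite ft gu hornerD.
  - by move=> f g [t ft] [u gu]; exists (t * u) => r; rewrite ft gu hornerM.
  - by move=> i; exists 'X => r; rewrite hornerX !ord1 mxE mulr1n.
elim=> {A} [p|p|A _ hA|A B _ hA _ hB|A B _ hA _ hB].
- have [q hq] := mpoly1 p; have := tame_sgr (fun x => x = 0) q.
  by congr tame; apply/seteqP; split => r /=; rewrite hq => /eqP h;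
     apply/eqP; move: h; rewrite sgr_eq0.
- have [q hq] := mpoly1 p; have := tame_sgr (fun x => 0 < x) q.
  by congr tame; apply/seteqP; split => r /=; rewrite hq sgr_gt0.
- by apply: (tame_combine hA hA) => x y /= ->.
- by apply: (tame_combine hA hB) => x y /= -> ->.
- by apply: (tame_combine hA hB) => x y /= -> ->.
Qed.

(* The supremum is the smallest of the exceptional points s that bound A from above. *)
Lemma tame_lub (A : set R) : tame A -> A !=set0 -> has_ubound A ->
  exists2 b, ubound A b & forall c, ubound A c -> b <= c.
Proof.
move=> [s hs] [a0 Aa0] [b0 ub0].
(* Finitely many points, none of which bounds A from above, are all exceeded by a single element of
   A. *)
have above (t : seq R) : (forall z, z \in t -> ~ ubound A z) ->
    exists2 x, A x & forall z, z \in t -> z < x.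
  elim: t => [|z t IHt] ht; first by exists a0.
  have [|x Ax hx] := IHt; first by move=> w wt; apply: ht; rewrite inE wt orbT.
  have /existsNP[y /not_implyP[Ay /negP]] := ht z (mem_head _ _).
  rewrite -ltNge => zy; exists (Num.max x y); first by case: (leP x y).
  move=> w; rewrite inE lt_max => /predU1P[->|/hx ->//]; by rewrite zy orbT.
have below (t : seq R) : t = [::] \/ exists2 m, m \in t & forall z, z \in t -> m <= z.
  elim: t => [|z t IHt]; [by left|right].
  have [->|[m mt hm]] := IHt.
    by exists z; rewrite ?mem_head // => w; rewrite inE => /eqP ->.
  exists (Num.min z m); first by rewrite inE; case: (leP z m); rewrite ?eqxx ?mt ?orbT.
  by move=> w; rewrite inE ge_min => /predU1P[->|/hm ->]; rewrite ?lexx ?orbT.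
(* If no point of s bounds A, some x in A lies beyond all of s. Then A contains everything to the
   right of x, including b0 + 1, which exceeds its bound b0. *)
have [e|[b]] := below [seq z <- s | `[< ubound A z >]].
  have [|x Ax hx] := above s.
    move=> z zs /asboolP uz; suff : z \in [::] by [].
    by rewrite -e mem_filter uz.
  have xb : x < b0 + 1 by rewrite (le_lt_trans (ub0 _ Ax)) // ltrDl.
  have Ab : A (b0 + 1).
    apply/(hs _ _ (ltW xb)) => // z /hx zx /andP[].
    by rewrite leNgt zx.
  by have := ub0 _ Ab; rewrite leNgt ltrDl ltr01.
rewrite mem_filter => /andP[/asboolP ub _] hb.
exists b => // c uc; rewrite leNgt; apply/negP => cb.
(* Some x in A lies beyond all points of s below b. If c < b bounded A, no point of s would lie
   between x and the midpoint m of c and b, so m would be in A although m > c. *)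
have [z|x Ax hx] := above [seq z <- s | z < b].
  rewrite mem_filter => /andP[zb zs] uz; have := hb z.
  by rewrite mem_filter zs (asboolT uz) leNgt zb => /(_ erefl).
have [cm mb] := midf_lt cb; set m := (c + b) / 2%:R in cm mb.
have xm : x < m by rewrite (le_lt_trans (uc _ Ax)).
have Am : A m.
  apply/(hs _ _ (ltW xm)) => // z zs /andP[xz zm].
  by have := hx z; rewrite mem_filter zs (le_lt_trans zm mb) ltNge xz => /(_ erefl).
by have := uc _ Am; rewrite leNgt cm.
Qed.

End Tame.

(** * Cluster points of decreasing semialgebraic families *)

Section Cluster.
Variable R : rcfType.

Lemma semialgebraic_iff n (A B : set 'rV[R]_n) :
  (forall x, A x <-> B x) -> semialgebraic A -> semialgebraic B.
Proof. by move=> AB; rewrite (_ : A = B) //; apply/seteqP; split => x /AB. Qed.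

Lemma ball_rowP n (p x : 'rV[R]_n) (d : R) :
  ball p d x <-> 0 < d /\ forall i, `|p ord0 i - x ord0 i| < d.
Proof.
split=> [[d0 h]|[d0 h]]; split=> // i; first exact: h.
by move=> j; rewrite ord1; exact: h.
Qed.

Lemma semialgebraic_ball m n (f g : 'rV[R]_m -> 'rV[R]_n) (d : 'rV[R]_m -> R) :
  polynomial_map f -> polynomial_map g -> polynomial_fun d ->
  semialgebraic [set z | ball (f z) (d z) (g z)].
Proof.
move=> pf pg pd.
apply: (@semialgebraic_iff _ ([set z | cst 0 z < d z] `&` [set z | forall i,
   ([set z | g z ord0 i - d z < f z ord0 i] `&`
    [set z | f z ord0 i < g z ord0 i + d z]) z])).
  move=> z; split=> [[d0 h]|/ball_rowP[d0 h]]; [apply/ball_rowP|]; split=> // i.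
    by rewrite ltr_distl; have [-> ->] := h i.
  by have := h i; rewrite ltr_distl => /andP.
apply: semialgebraicI; first by apply: semialgebraic_lt; polynomial.
by apply: semialgebraic_forall => i; apply: semialgebraicI; apply: semialgebraic_lt;
   polynomial.
Qed.

Definition semialgebraic_family n (C : R -> set 'rV[R]_n) :=
  semialgebraic [set z : 'rV[R]_(n + 1) | C (last_coord z) (lsubmx z)].

Lemma semialgebraic_family_comp m n (C : R -> set 'rV[R]_n)
    (f : 'rV[R]_m -> 'rV[R]_n) (d : 'rV[R]_m -> R) :
  semialgebraic_family C -> polynomial_map f -> polynomial_fun d ->
  semialgebraic [set z | C (d z) (f z)].
Proof.
move=> hC pf pd.
have pfd : polynomial_map (fun z => pair_pt (f z) (d z)).
  by polynomial.
apply: semialgebraic_iff (semialgebraic_preimage pfd hC) => z /=.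
by rewrite /last_coord row_mxKl row_mxKr mxE mulr1n.
Qed.

(* r is the limit, as d -> 0, of the infimum of the i-th coordinate on C d. *)
Lemma cluster_coord n (C : R -> set 'rV[R]_n) (i : 'I_n) (M : R) :
  semialgebraic_family C ->
  (forall d e : R, 0 < d <= e -> C d `<=` C e) ->
  (forall d : R, 0 < d -> C d !=set0) ->
  (forall (d : R) x, 0 < d -> C d x -> `|x ord0 i| <= M) ->
  exists r, forall d : R, 0 < d -> exists2 x, C d x & `|r - x ord0 i| < d.
Proof.
move=> hC mC nC bC.
(* [A] below collects the lower bounds of the i-th coordinate on some [C d], so its supremum is the
   limit sought. [A'] is the same set in terms of rows of length 1 and existential quantifiers, the
   form that [semialgebraic_exists] handles. *)
pose A' : set 'rV[R]_1 := [set r | exists d : 'rV[R]_1, 0 < d ord0 ord0 /\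
  ~ exists x : 'rV[R]_n, C (d ord0 ord0) x /\ x ord0 i < r ord0 ord0].
pose A := [set r | exists d : R, 0 < d /\ forall x, C d x -> r <= x ord0 i].
have tA : tame A.
  have -> : A = [set r | A' r%:M].
    apply/seteqP; split=> r [d [d0 h]].
      exists d%:M; rewrite !mxE !mulr1n; split=> // -[x [/h]].
      by rewrite leNgt => /negP.
    exists (d ord0 ord0); split=> // x Cx; rewrite leNgt; apply/negP => xr.
    by apply: h; exists x; rewrite mxE mulr1n.
  apply/semialgebraic_tame/semialgebraic_exists.
  apply: semialgebraicI.
    apply: (semialgebraic_lt (@polynomial_fun_cst _ _ 0)).
    by polynomial.
  apply/semialgebraicC/semialgebraic_exists/semialgebraicI.
    by apply: semialgebraic_family_comp => //; polynomial.
  by apply: semialgebraic_lt; polynomial.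
have [||b ub lb] := tame_lub tA.
- by exists (- M), 1; split=> // x /bC; rewrite ler_norml => /(_ ltr01) /andP[].
- exists M => r [d [d0 h]]; have [x Cx] := nC _ d0.
  by rewrite (le_trans (h _ Cx)) // (le_trans (ler_norm _)) // (bC _ _ d0 Cx).
exists b => d d0.
have [r [[e [e0 h]] br]] : exists r, A r /\ b - d < r.
  apply: contrapT => h; have : b <= b - d.
    by apply: lb => r Ar; rewrite leNgt; apply/negP => ?; apply: h; exists r.
  by rewrite leNgt ltrBlDr ltrDl d0.
have m0 : 0 < Num.min d e by rewrite lt_min d0.
(* Otherwise b + d would be a lower bound on [C (Num.min d e)], hence an element of [A] above its
   supremum b. *)
have [x Cx xb] : exists2 x, C (Num.min d e) x & x ord0 i < b + d.
  apply: contrapT => h'; suff /ub : A (b + d) by rewrite leNgt ltrDl d0.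
  exists (Num.min d e); split=> // x Cx; rewrite leNgt; apply/negP => ?.
  by apply: h'; exists x.
exists x; first by apply: mC Cx; rewrite m0 ge_min lexx.
have : r <= x ord0 i by apply: h; apply: mC Cx; rewrite m0 ge_min lexx orbT.
rewrite distrC ltr_distl xb andbT; exact: lt_le_trans.
Qed.

Lemma semialgebraic_cluster n (C : R -> set 'rV[R]_n) (M : R) :
  semialgebraic_family C ->
  (forall d e : R, 0 < d <= e -> C d `<=` C e) ->
  (forall d : R, 0 < d -> C d !=set0) ->
  (forall (d : R) x i, 0 < d -> C d x -> `|x ord0 i| <= M) ->
  exists p, forall d : R, 0 < d -> exists2 x, C d x & ball p d x.
Proof.
move=> hC mC nC bC.
have coords m : (m <= n)%N -> exists p : 'rV[R]_n, forall d : R, 0 < d ->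
    exists2 x, C d x & forall i : 'I_n, (i < m)%N -> `|p ord0 i - x ord0 i| < d;
  last first.
  have [p hp] := coords n (leqnn n); exists p => d d0.
  have [x Cx hx] := hp d d0; exists x => //.
  by apply/ball_rowP; split=> // i; exact: hx.
elim: m => [_|m IHm mn].
  by exists 0 => d /nC[x Cx]; exists x.
have [p hp] := IHm (ltnW mn).
(* Restricting [C d] to points that agree up to d with the coordinates already found keeps the
   family semialgebraic, decreasing and nonempty, so the next coordinate can be found inside it. *)
pose D d : set 'rV[R]_n :=
  [set x | C d x /\ forall i : 'I_n, (i < m)%N -> `|p ord0 i - x ord0 i| < d].
have [|d e de x [Cx h]|d /hp[x Cx h]|d x d0 [Cx _]|r hr] :=
    @cluster_coord n D (Ordinal mn) M.
- apply: semialgebraicI; first exact: hC.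
  apply: semialgebraic_forall => i; have [im|mi] := ltnP i m; last first.
    by apply: semialgebraic_iff (@semialgebraicT _ _) => x; split.
  apply: (@semialgebraic_iff _ ([set z | lsubmx z ord0 i - last_coord z < cst (p ord0 i) z]
      `&` [set z | cst (p ord0 i) z < lsubmx z ord0 i + last_coord z])).
    move=> z; rewrite /= ltr_distl; split=> [[-> ->]//|/(_ isT)/andP//].
  by apply: semialgebraicI; apply: semialgebraic_lt; polynomial.
- split; first exact: mC Cx.
  by move=> i /h pd; rewrite (lt_le_trans pd) //; case/andP: de.
- by exists x.
- exact: bC Cx.
(* Coordinate m becomes r. Those after m also receive r, but only as a placeholder, since nothing is
   required of them yet. *)
exists (\row_i if (i < m)%N then p ord0 i else r) => d /hr[x [Cx h] hx].
exists x => // i; rewrite mxE ltnS leq_eqVlt => /predU1P[im|im]; last by rewrite im h.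
by rewrite im ltnn; move: hx; congr (`|r - x ord0 _| < d); apply/val_inj.
Qed.

End Cluster.

(** * Semialgebraic maps, continuity and factorization through a surjection *)

Section SemialgebraicMaps.
Variable R : rcfType.

Lemma within_continuousP (T U : pseudoMetricType R) (A : set T) (f : T -> U) :
  {within A, continuous f} <->
  forall x, A x -> forall e : R, 0 < e ->
    exists2 d, 0 < d & forall y, A y -> ball x d y -> ball (f x) e (f y).
Proof.
rewrite subspace_continuousP; split=> h x Ax.
  move=> e e0; have /cvg_ballP/(_ _ e0) := h x Ax.
  by rewrite near_withinE => /nbhs_ballP[d d0 hd]; exists d => // y Ay /hd; apply.
apply/cvg_ballP => e /(h x Ax)[d d0 hd]; rewrite near_withinE.
by apply/nbhs_ballP; exists d => // y xy Ay; exact: hd.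
Qed.

Lemma graph_onP m n (A : set 'rV[R]_m) (f : 'rV[R]_m -> 'rV[R]_n) w :
  graph_on A f w <-> A (lsubmx w) /\ f (lsubmx w) = rsubmx w.
Proof.
split=> [[x Ax <-]|[Aw fw]]; first by rewrite row_mxKl row_mxKr.
by exists (lsubmx w); rewrite // fw hsubmxK.
Qed.

Lemma semialgebraic_map_poly m n (A : set 'rV[R]_m) (f : 'rV[R]_m -> 'rV[R]_n) :
  semialgebraic A -> polynomial_map f -> semialgebraic_map A setT f.
Proof.
move=> hA pf; split=> //; first exact: semialgebraicT.
apply: (@semialgebraic_iff _ _ ([set w | A (lsubmx w)] `&`
    [set w | forall i, f (lsubmx w) ord0 i = rsubmx w ord0 i])).
  move=> w; rewrite graph_onP /=; split=> -[Aw fw]; split=> //.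
    exact/rowP.
  by move=> i; rewrite fw.
have pl : polynomial_map (@lsubmx R 1 m n) by polynomial.
apply: semialgebraicI; first exact: semialgebraic_preimage hA.
apply: semialgebraic_forall => i; apply: semialgebraic_eq; last by polynomial.
exact: polynomial_fun_comp pl (pf i).
Qed.

Lemma semialgebraic_map_comp m n q (A : set 'rV[R]_m) (B : set 'rV[R]_n)
    (f : 'rV[R]_m -> 'rV[R]_n) (g : 'rV[R]_n -> 'rV[R]_q) :
  semialgebraic A -> polynomial_map f -> (forall x, A x -> B (f x)) ->
  semialgebraic_map B setT g -> semialgebraic_map A setT (fun x => g (f x)).
Proof.
move=> hA pf AB [_ hT _ hg]; split=> //.
have pl : polynomial_map (@lsubmx R 1 m q) by polynomial.
have pw : polynomial_map (fun w : 'rV[R]_(m + q) => row_mx (f (lsubmx w)) (rsubmx w)).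
  by polynomial; exact: polynomial_map_comp pl pf.
apply: semialgebraic_iff (semialgebraicI (semialgebraic_preimage pl hA)
  (semialgebraic_preimage pw hg)) => w.
rewrite graph_onP /setI /= graph_onP row_mxKl row_mxKr.
by split=> [[Aw [_ ->]]|[Aw <-]] //; split=> //; split=> //; exact: AB.
Qed.

Lemma semialgebraic_map_row_mx m n q (A : set 'rV[R]_m)
    (f : 'rV[R]_m -> 'rV[R]_n) (g : 'rV[R]_m -> 'rV[R]_q) :
  semialgebraic_map A setT f -> semialgebraic_map A setT g ->
  semialgebraic_map A setT (fun x => row_mx (f x) (g x)).
Proof.
move=> [hA _ _ hf] [_ _ _ hg]; split=> //; first exact: semialgebraicT.
have pf : polynomial_map (fun w : 'rV[R]_(m + (n + q)) =>
  row_mx (lsubmx w) (lsubmx (rsubmx w))) by polynomial.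
have pg : polynomial_map (fun w : 'rV[R]_(m + (n + q)) =>
  row_mx (lsubmx w) (rsubmx (rsubmx w))) by polynomial.
apply: semialgebraic_iff (semialgebraicI (semialgebraic_preimage pf hf)
  (semialgebraic_preimage pg hg)) => w.
rewrite graph_onP /setI /= !graph_onP !row_mxKl !row_mxKr.
split=> [[[Aw ->] [_ ->]]|[Aw <-]]; first by rewrite hsubmxK.
by rewrite row_mxKl row_mxKr.
Qed.

(** The image is a projection of the graph. The two factors are exchanged first, because
    [semialgebraic_exists] eliminates the last coordinates. *)
Lemma semialgebraic_image m n (A : set 'rV[R]_m) (B : set 'rV[R]_n) f :
  semialgebraic_map A B f -> semialgebraic (f @` A).
Proof.
move=> [_ _ _ hf].
have pw : polynomial_map (fun w : 'rV[R]_(n + m) => row_mx (rsubmx w) (lsubmx w)).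
  by polynomial.
apply: semialgebraic_iff (semialgebraic_exists
  (P := fun y x => graph_on A f (row_mx x y)) (semialgebraic_preimage pw hf)) => y /=.
split=> [[x /graph_onP]|[x Ax fx]].
  by rewrite row_mxKl row_mxKr => -[Ax fx]; exists x.
by exists x; apply/graph_onP; rewrite row_mxKl row_mxKr.
Qed.

Lemma semialgebraic_map_factor d m n (K : set 'rV[R]_d) (F : 'rV[R]_d -> 'rV[R]_m)
    (G : 'rV[R]_d -> 'rV[R]_n) (H : 'rV[R]_m -> 'rV[R]_n) (B : set 'rV[R]_n) :
  semialgebraic_map K setT F -> semialgebraic_map K setT G ->
  (forall z, K z -> H (F z) = G z) -> semialgebraic B ->
  (forall z, K z -> B (G z)) -> semialgebraic_map (F @` K) B H.
Proof.
move=> hF hG HF hB KB; split=> //; first exact: semialgebraic_image hF.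
  by move=> _ [z Kz <-]; rewrite HF //; exact: KB.
apply: semialgebraic_iff (semialgebraic_image (semialgebraic_map_row_mx hF hG)) => w.
rewrite graph_onP; split=> [[z Kz <-]|[[z Kz Fz] Hw]].
  by rewrite row_mxKl row_mxKr HF //; split=> //; exists z.
by exists z => //; rewrite Fz -HF // Fz Hw hsubmxK.
Qed.

(* If H were discontinuous at w, the points z of K with F z close to w but G z far from H w
   would cluster at some p in K with F p = w and G p <> H w. *)
Lemma continuous_factor d m n (K : set 'rV[R]_d) (M : R)
    (F : 'rV[R]_d -> 'rV[R]_m) (G : 'rV[R]_d -> 'rV[R]_n) (H : 'rV[R]_m -> 'rV[R]_n) :
  closed K -> (forall z i, K z -> `|z ord0 i| <= M) ->
  semialgebraic_map K setT F -> semialgebraic_map K setT G ->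
  {within K, continuous F} -> {within K, continuous G} ->
  (forall z, K z -> H (F z) = G z) -> {within F @` K, continuous H}.
Proof.
move=> clK bK sF sG cF cG HF; apply/within_continuousP => w Kw e e0.
pose C (t : R) : set 'rV[R]_d := [set z | K z /\
  (ball w t (F z) /\ ~ ball (H w) e (G z))].
apply: contrapT => h.
have nC (t : R) : 0 < t -> C t !=set0.
  move=> t0; apply: contrapT => nCt; apply: h; exists t => // _ [z Kz <-] wz.
  by rewrite HF //; apply: contrapT => ?; apply: nCt; exists z.
have mC (s t : R) : 0 < s <= t -> C s `<=` C t.
  by move=> /andP[_ st] z [Kz [wz nz]]; split=> //; split=> //; exact: le_ball st _ _.
have bC (t : R) x i : 0 < t -> C t x -> `|x ord0 i| <= M by move=> _ [/bK].
have sC : semialgebraic_family C.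
  have sFG := semialgebraic_map_row_mx sF sG; case: sFG => _ _ _ sFG.
  have pw : polynomial_map (fun z : 'rV[R]_(d + 1 + (m + n)) =>
    row_mx (lsubmx (lsubmx z)) (rsubmx z)) by polynomial.
  (* F and G need not be polynomial, so their values enter through a quantified y on the graph of
     (F, G). *)
  apply: (@semialgebraic_iff _ _ [set z : 'rV[R]_(d + 1) | exists y,
     graph_on K (fun x => row_mx (F x) (G x)) (row_mx (lsubmx z) y) /\
     (ball w (last_coord z) (lsubmx y) /\ ~ ball (H w) e (rsubmx y))]).
    move=> z; split=> [[y [/graph_onP]]|[Kz hz]].
      by rewrite row_mxKl row_mxKr => -[Kz <-]; rewrite row_mxKl row_mxKr.
    exists (row_mx (F (lsubmx z)) (G (lsubmx z))).
    by rewrite graph_onP !row_mxKl !row_mxKr.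
  apply: semialgebraic_exists; apply: semialgebraicI.
    exact: semialgebraic_preimage pw sFG.
  apply: semialgebraicI; first by apply: semialgebraic_ball; polynomial.
  by apply: semialgebraicC; apply: semialgebraic_ball; polynomial.
have [p hp] := semialgebraic_cluster sC mC nC bC.
have Kp : K p.
  apply: clK => U /nbhs_ballP[t /= t0 tU]; have [x [Kx _] px] := hp t t0.
  by exists x; split=> //; exact: tU.
have Fp : F p = w.
  apply: contrapT => Fpw; have [i Fi] : exists i, F p ord0 i != w ord0 i.
    apply: contrapT => hi; apply: Fpw; apply/rowP => i.
    by apply/eqP; apply: contrapT => /negP ?; apply: hi; exists i.
  (* With t half the gap in coordinate i, some x in K has [F x] within t of both [F p] and w, which
     is impossible. *)
  pose t := `|F p ord0 i - w ord0 i| / 2%:R.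
  have t0 : 0 < t by rewrite divr_gt0 ?normr_gt0 ?subr_eq0.
  have [s s0 hs] := (within_continuousP _ _).1 cF p Kp t t0.
  have st0 : 0 < Num.min s t by rewrite lt_min s0.
  have [sl tl] : Num.min s t <= s /\ Num.min s t <= t by rewrite !ge_min !lexx orbT.
  have [x [Kx [wx _]] px] := hp _ st0.
  have /ball_rowP[_ /(_ i) h1] := hs x Kx (le_ball sl px).
  have /ball_rowP[_ /(_ i) h2] := le_ball tl wx.
  suff : `|F p ord0 i - w ord0 i| < t + t by rewrite /t -splitr ltxx.
  rewrite (le_lt_trans (ler_distD (F x ord0 i) _ _)) // ltrD //.
  by rewrite distrC.
have [s s0 hs] := (within_continuousP _ _).1 cG p Kp e e0.
have [x [Kx [_ nx]] px] := hp s s0.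
by apply: nx; rewrite -Fp HF //; exact: hs.
Qed.

Lemma polynomial_map_continuous m n (f : 'rV[R]_m -> 'rV[R]_n) :
  polynomial_map f -> continuous f.
Proof.
move=> pf x; apply: (@cvg_ballP _ _ _ (nbhs x) _ _ _).2 => e e0.
pose P (g : 'rV[R]_m -> R) : Prop := continuous g.
have cf i : P (fun x => f x ord0 i).
  have [p ->] := pf i; apply: (@meval_closed _ _ P m p (fun j x => x ord0 j)).
  - by move=> c; exact: cst_continuous.
  - by move=> g h cg ch y; exact: (@cvgD _ _ _ (nbhs y) _ g h _ _ (cg y) (ch y)).
  - by move=> g h cg ch y; exact: (@cvgM _ _ (nbhs y) _ g h _ _ (cg y) (ch y)).
  - by move=> j; exact: coord_continuous.
have Fx : Filter (nbhs x) by exact: _.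
have ci i : nbhs x [set y | ball (f x ord0 i) e (f y ord0 i)].
  exact: (@cvg_ballP _ _ _ (nbhs x) _ (fun y => f y ord0 i) _).1 (cf i x) e e0.
have := @filter_forall _ _ (fun i y => ball (f x ord0 i) e (f y ord0 i)) _ Fx ci.
by apply: (@filterS _ _ Fx) => y h; apply/ball_rowP; split=> // i; exact: h.
Qed.

Lemma continuous_within_comp m n (U : pseudoMetricType R) (A : set 'rV[R]_m)
    (B : set 'rV[R]_n) (f : 'rV[R]_m -> 'rV[R]_n) (g : 'rV[R]_n -> U) :
  continuous f -> (forall x, A x -> B (f x)) -> {within B, continuous g} ->
  {within A, continuous (fun x => g (f x))}.
Proof.
move=> cf AB /within_continuousP cg; apply/within_continuousP => x Ax e e0.
have [d d0 hd] := cg _ (AB _ Ax) e e0.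
have /cvg_ballP/(_ _ d0)/nbhs_ballP[s s0 hs] := cf x.
by exists s => // y Ay /hs fxy; apply: hd => //; exact: AB.
Qed.

Lemma within_continuous_row_mx m n q (A : set 'rV[R]_m)
    (f : 'rV[R]_m -> 'rV[R]_n) (g : 'rV[R]_m -> 'rV[R]_q) :
  {within A, continuous f} -> {within A, continuous g} ->
  {within A, continuous (fun x => row_mx (f x) (g x))}.
Proof.
move=> /within_continuousP cf /within_continuousP cg.
apply/within_continuousP => x Ax e e0.
have [d d0 hd] := cf _ Ax e e0; have [s s0 hs] := cg _ Ax e e0.
exists (Num.min d s); first by rewrite lt_min d0.
have [dl sl] : Num.min d s <= d /\ Num.min d s <= s by rewrite !ge_min !lexx orbT.
move=> y Ay xy; have /ball_rowP[_ h1] := hd y Ay (le_ball dl xy).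
have /ball_rowP[_ h2] := hs y Ay (le_ball sl xy).
by apply/ball_rowP; split=> // i; rewrite !mxE; case: (fintype.split i).
Qed.

End SemialgebraicMaps.

(** * Closed bounded sets, bounds for continuous functions, and cylinders *)

Lemma closed_ballP (R : rcfType) n (A : set 'rV[R]_n) :
  closed A <-> forall p, (forall d : R, 0 < d -> exists2 x, A x & ball p d x) -> A p.
Proof.
split=> [clA p h|h p clp]; last first.
  by apply: h => d d0; have [x [Ax px]] := clp _ (nbhsx_ballx p d d0); exists x.
by apply: clA => B /nbhs_ballP[d /= /h[x Ax px] dB]; exists x; split=> //; exact: dB.
Qed.

Lemma bounded_set_coord (R : rcfType) n (A : set 'rV[R]_n) : bounded_set A ->
  exists M : R, forall x i, A x -> `|x ord0 i| <= M.
Proof.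
(* [bounded_set] gives a bound for each number strictly greater than M, hence M + 1. *)
move=> [M [_ hM]]; exists (M + 1) => x i Ax.
have := hM (M + 1); rewrite ltrDl => /(_ ltr01 x Ax); apply: le_trans.
rewrite [leRHS]/Num.Def.normr /= mx_normrE; apply/bigmax_geP; right => /=.
by exists (ord0, i).
Qed.

(** Replaces the extreme value theorem. If f were unbounded, the sets where f > 1 / d would cluster
    at some p in A as d -> 0. Near p continuity gives f < [|f p| + 1], which contradicts f > 1 / d
    once d is at most the inverse of that bound. *)
Lemma within_continuous_bounded (R : rcfType) n (A : set 'rV[R]_n) (B : set 'rV[R]_1)
    (M : R) (f : 'rV[R]_n -> R) :
  closed A -> (forall x i, A x -> `|x ord0 i| <= M) ->
  semialgebraic_map A B (fun x => (f x)%:M) -> {within A, continuous f} ->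
  exists N, forall x, A x -> f x <= N.
Proof.
move=> /closed_ballP clA bA [_ _ _ sf] /within_continuousP cf.
apply: contrapT => h.
(* The condition f x > 1 / d is written without division, so that it is polynomial in d and f x. *)
pose C (d : R) : set 'rV[R]_n := [set x | A x /\ 1 < d * f x].
have [|d e /andP[d0 de] x [Ax dx]|d d0|d x i _ [/bA //]|p hp] :=
    @semialgebraic_cluster R n C M.
- have pw : polynomial_map (fun z : 'rV[R]_(n + 1 + 1) =>
    row_mx (lsubmx (lsubmx z)) (rsubmx z)) by polynomial.
  apply: (@semialgebraic_iff _ _ [set z : 'rV[R]_(n + 1) | exists y,
     graph_on A (fun x => (f x)%:M) (row_mx (lsubmx z) y) /\
     1 < last_coord z * y ord0 ord0]).
    move=> z; split=> [[y [/graph_onP]]|[Az hz]].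
      by rewrite row_mxKl row_mxKr => -[Az <-]; rewrite mxE mulr1n.
    exists (f (lsubmx z))%:M.
    by rewrite graph_onP !row_mxKl !row_mxKr mxE mulr1n.
  apply: semialgebraic_exists; apply: semialgebraicI.
    exact: semialgebraic_preimage pw sf.
  by apply: semialgebraic_lt; polynomial.
- split=> //; apply: (lt_le_trans dx); rewrite ler_wpM2r //.
  by rewrite -(pmulr_rge0 _ d0) (le_trans ler01) // ltW.
- apply: contrapT => nC; apply: h; exists d^-1 => x Ax.
  rewrite leNgt; apply/negP => dx; apply: nC; exists x; split=> //.
  by rewrite -ltr_pdivrMl // mulr1.
have Ap : A p by apply: clA => d /hp[x [Ax _] px]; exists x.
have [d d0 hd] := cf p Ap 1 ltr01.
have q0 : 0 < `|f p| + 1 by rewrite ltr_wpDl.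
have t0 : 0 < Num.min d (`|f p| + 1)^-1 by rewrite lt_min d0 invr_gt0.
have [x [Ax hx] px] := hp _ t0.
have [td tq] : Num.min d (`|f p| + 1)^-1 <= d /\
    Num.min d (`|f p| + 1)^-1 <= (`|f p| + 1)^-1 by rewrite !ge_min !lexx orbT.
have : `|f p - f x| < 1 := hd x Ax (le_ball td px).
rewrite distrC ltr_distl => /andP[_ fx].
have fxq : f x < `|f p| + 1 by rewrite (lt_le_trans fx) // lerD2r ler_norm.
have : 1 < 1 :> R.
  rewrite (lt_le_trans hx) // (le_trans (ler_wpM2l (ltW t0) (ltW fxq))) //.
  by rewrite -ler_pdivlMr // div1r.
by rewrite ltxx.
Qed.

Lemma pair_ptK (R : rcfType) k (z : 'rV[R]_(k + 1)) :
  pair_pt (lsubmx z) (last_coord z) = z.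
Proof.
rewrite /pair_pt (_ : _%:M = rsubmx z) ?hsubmxK //.
by apply/rowP => i; rewrite /last_coord !ord1 !mxE mulr1n.
Qed.

Lemma lsubmx_pair_pt (R : rcfType) k (x : 'rV[R]_k) t : lsubmx (pair_pt x t) = x.
Proof. exact: row_mxKl. Qed.

Lemma last_coord_pair_pt (R : rcfType) k (x : 'rV[R]_k) t : last_coord (pair_pt x t) = t.
Proof. by rewrite /last_coord row_mxKr mxE mulr1n. Qed.

Lemma coord_pair_le (R : rcfType) k (z : 'rV[R]_(k + 1)) (M : R) :
  (forall i, `|lsubmx z ord0 i| <= M) -> `|last_coord z| <= M ->
  forall i, `|z ord0 i| <= M.
Proof.
move=> hl hr i; rewrite -[z]hsubmxK mxE; case: (fintype.split i) => // j.
by rewrite (ord1 j).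
Qed.

Lemma semialgebraic_cylinder (R : rcfType) k (A : set 'rV[R]_k) :
  semialgebraic A -> semialgebraic (cylinder A).
Proof.
move=> hA; have pl : polynomial_map (@lsubmx R 1 k 1) by polynomial.
apply: (@semialgebraic_iff _ _ ([set z | A (lsubmx z)] `&`
   ([set z | cst 0 z <= last_coord z] `&` [set z | last_coord z <= cst 1 z]))).
  by move=> z; split=> [[Az [/= h1 h2]]|[Az /andP[]]]; split=> //; apply/andP.
apply: semialgebraicI; first exact: semialgebraic_preimage hA.
by apply: semialgebraicI; apply: semialgebraic_le; polynomial.
Qed.

Lemma ball_lsubmx (R : rcfType) m n (p x : 'rV[R]_(m + n)) (d : R) :
  ball p d x -> ball (lsubmx p) d (lsubmx x).
Proof.
by move=> /ball_rowP[d0 h]; apply/ball_rowP; split=> // i; rewrite !mxE; exact: h.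
Qed.

Lemma ball_last_coord (R : rcfType) n (p x : 'rV[R]_(n + 1)) (d : R) :
  ball p d x -> `|last_coord p - last_coord x| < d.
Proof. by move=> /ball_rowP[d0 h]; rewrite /last_coord !mxE; exact: h. Qed.

(** Applied with f = [ell] to see that V is closed, then with f = 1 for the cylinder over V. *)
Lemma closed_subgraph (R : rcfType) n (A : set 'rV[R]_n) (f : 'rV[R]_n -> R) :
  closed A -> {within A, continuous f} ->
  closed [set z : 'rV[R]_(n + 1) | A (lsubmx z) /\ 0 <= last_coord z <= f (lsubmx z)].
Proof.
move=> /closed_ballP clA /within_continuousP cf; apply/closed_ballP => p hp.
have Ap : A (lsubmx p).
  by apply: clA => d /hp[x [Ax _] px]; exists (lsubmx x) => //; exact: ball_lsubmx.
split=> //; apply/andP; split.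
  rewrite leNgt; apply/negP; rewrite -oppr_gt0 => /hp[x [_ /andP[x0 _]]].
  move=> /ball_last_coord; rewrite distrC ltr_distl subrr => /andP[_].
  by rewrite ltNge x0.
rewrite leNgt; apply/negP => lp.
(* Half of the excess of p over the graph: a nearby point of the set moves the last coordinate and f
   by less than e each, too little to close the gap. *)
pose e := (last_coord p - f (lsubmx p)) / 2%:R.
have e0 : 0 < e by rewrite divr_gt0 // subr_gt0.
have [d d0 hd] := cf _ Ap e e0.
have de0 : 0 < Num.min d e by rewrite lt_min d0.
have [dl el] : Num.min d e <= d /\ Num.min d e <= e by rewrite !ge_min !lexx orbT.
have [x [Ax /andP[_ xf]] px] := hp _ de0.
have : `|f (lsubmx p) - f (lsubmx x)| < e := hd _ Ax (le_ball dl (ball_lsubmx px)).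
have := lt_le_trans (ball_last_coord px) el.
rewrite ltr_distl => /andP[_ h1]; rewrite distrC ltr_distl => /andP[_ h2].
have : last_coord p < f (lsubmx p) + e + e.
  by rewrite (lt_trans h1) // ltrD2r (le_lt_trans xf).
by rewrite -addrA -splitr addrC subrK ltxx.
Qed.

(** * The contraction of the image along the paths *)

Theorem proposition2 (R : rcfType) (k : nat) (V : set 'rV[R]_(k + 1))
    (gamma : 'rV[R]_(k + 1) -> 'rV[R]_k)
    (hgamma : parametrized_path V gamma)
    (hclosed : closed (path_base V))
    (hbounded : bounded_set (path_base V)) :
  semialgebraically_contractible (gamma @` V).
Proof.
move: hgamma => [sg cg [ell [a [[sl cl] [VE g0 gl g4 g5]]]]].
set U := path_base V in sl cl VE g0 gl g4 g5 hclosed hbounded.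
have VP z : V z <-> U (lsubmx z) /\ 0 <= last_coord z <= ell (lsubmx z) by rewrite {1}VE.
have [M bU] := bounded_set_coord hbounded.
have [N bell] := within_continuous_bounded hclosed bU sl cl.
have clV : closed V by rewrite VE; exact: closed_subgraph.
pose K := cylinder V.
have clK : closed K.
  by apply: (closed_subgraph (f := cst 1) clV); exact/continuous_subspaceT/cst_continuous.
(* The coordinates of z come from U, from the time along the path and from the homotopy time,
   bounded by M, N and 1. Absolute values make the sum a common bound, as M and N have no prescribed
   sign. *)
have bK z i : K z -> `|z ord0 i| <= `|M| + `|N| + 1.
  move=> [/VP[Uz /andP[z0 zl]] /andP[t0 t1]].
  have [M0 N0] : 0 <= `|M| /\ 0 <= `|N| by rewrite !normr_ge0.
  apply: coord_pair_le i; last by rewrite ger0_norm // (le_trans t1) // lerDr addr_ge0.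
  apply: coord_pair_le => [i|].
    by rewrite (le_trans (bU _ i Uz)) // (le_trans (ler_norm M)) // -addrA lerDl addr_ge0.
  rewrite ger0_norm // (le_trans zl) // (le_trans (bell _ Uz)) //.
  by rewrite (le_trans (ler_norm N)) // addrAC lerDr addr_ge0.
have sV : semialgebraic V by case: sg.
have sK : semialgebraic K by exact: semialgebraic_cylinder.
(* The sliding map (x, s, t) -> (x, s (1 - t)). *)
pose phi (z : 'rV[R]_(k + 1 + 1)) : 'rV[R]_(k + 1) :=
  pair_pt (lsubmx (lsubmx z)) (last_coord (lsubmx z) * (1 - last_coord z)).
have pphi : polynomial_map phi by rewrite /phi; polynomial.
have shrink (s t : R) : 0 <= s -> 0 <= t <= 1 -> 0 <= s * (1 - t) <= s.
  move=> s0 /andP[t0 t1]; rewrite mulr_ge0 ?subr_ge0 //=.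
  by rewrite ler_piMr // gerBl.
have Kphi z : K z -> V (phi z).
  move=> [/VP[Uz /andP[z0 zl]] hz]; apply/VP.
  rewrite lsubmx_pair_pt last_coord_pair_pt; split=> //.
  by have /andP[-> /le_trans->] := shrink _ _ z0 hz.
(* The quotient map (x, s, t) -> (gamma (x, s), t) from K onto the cylinder over the image. *)
pose F (z : 'rV[R]_(k + 1 + 1)) : 'rV[R]_(k + 1) := row_mx (gamma (lsubmx z)) (rsubmx z).
(* An arbitrary preimage under gamma in V, with default 0 off the image. [HF] below shows that the
   choice does not affect [H] on the cylinder. *)
pose pre p := xget 0 [set v | V v /\ gamma v = p].
pose H (w : 'rV[R]_(k + 1)) := gamma (phi (row_mx (pre (lsubmx w)) (rsubmx w))).
have preP v : V v -> V (pre (gamma v)) /\ gamma (pre (gamma v)) = gamma v.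
  by move=> Vv; apply: (@xgetPex _ 0 [set u | V u /\ gamma u = gamma v]); exists v.
have HF z : K z -> H (F z) = gamma (phi z).
  move=> [Vz hz]; rewrite /H /F row_mxKl row_mxKr.
  have [] := preP _ Vz; move: (pre _) => v Vv gv.
  have [/VP[Uz zl] /VP[Uv vl]] := (Vz, Vv).
  (* By (4), the chosen preimage v and the given point have the same time s. By (5), their paths
     then agree up to s, in particular at s (1 - t). *)
  have st : last_coord v = last_coord (lsubmx z).
    by apply: (g4 (lsubmx v) (lsubmx (lsubmx z))) => //; rewrite !pair_ptK.
  rewrite /phi row_mxKl (_ : last_coord (row_mx v _) = last_coord z); last first.
    by rewrite /last_coord row_mxKr.
  rewrite st; apply: (g5 _ _ (last_coord (lsubmx z))) => //.
  - by rewrite le_min andbA; case/andP: zl => -> ->; rewrite -st; case/andP: vl => _ ->.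
  - by rewrite -{1}st !pair_ptK.
  - by apply: shrink => //; case/andP: zl.
have cylE : cylinder (gamma @` V) = F @` K.
  apply/seteqP; split=> [w [[v Vv gv] hw]|_ [z [Vz hz] <-]].
    exists (row_mx v (rsubmx w)); last by rewrite /F row_mxKl row_mxKr gv hsubmxK.
    by split; rewrite ?row_mxKl // /last_coord row_mxKr.
  split; first by exists (lsubmx z); rewrite // /F row_mxKl.
  by rewrite /last_coord row_mxKr.
have pl : polynomial_map (@lsubmx R 1 (k + 1) 1) by polynomial.
have pr : polynomial_map (@rsubmx R 1 (k + 1) 1) by polynomial.
have Kl z : K z -> V (lsubmx z) by case.
have sF : semialgebraic_map K setT F.
  apply: semialgebraic_map_row_mx; last exact: semialgebraic_map_poly.
  exact: semialgebraic_map_comp sg.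
have sG : semialgebraic_map K setT (gamma \o phi).
  exact: semialgebraic_map_comp sg.
have cF : {within K, continuous F}.
  apply: within_continuous_row_mx; last first.
    exact/continuous_subspaceT/polynomial_map_continuous.
  exact: continuous_within_comp (polynomial_map_continuous pl) Kl cg.
have cG : {within K, continuous (gamma \o phi)}.
  exact: continuous_within_comp (polynomial_map_continuous pphi) Kphi cg.
have sS : semialgebraic (gamma @` V) by exact: semialgebraic_image sg.
exists a, H; rewrite cylE; split.
- by apply: semialgebraic_map_factor sF sG HF sS _ => z /Kphi Vz; exists (phi z).
- exact: continuous_factor clK bK sF sG cF cG HF.
(* At t = 0 the map [phi] leaves the preimage in place, so [H] returns the point itself. *)
- move=> _ [v Vv <-]; rewrite /H lsubmx_pair_pt.
  have [Vp gp] := preP _ Vv; rewrite -[RHS]gp.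
  rewrite [rsubmx _]row_mxKr -/(pair_pt _ _); congr gamma.
  by rewrite /phi lsubmx_pair_pt last_coord_pair_pt subr0 mulr1 pair_ptK.
(* At t = 1 the time along the path becomes 0, where every path is at a. *)
- move=> _ [v Vv <-]; rewrite /H lsubmx_pair_pt.
  have [/VP[Up _] _] := preP _ Vv; rewrite [rsubmx _]row_mxKr -/(pair_pt _ _).
  by rewrite /phi lsubmx_pair_pt last_coord_pair_pt subrr mulr0 g0.
Qed.
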